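(* Let $\mathbb{K}$ be a field of characteristic $0$. The set $\mathcal{HL}_4$ of $4$-dimensional Hom-Lie algebras over $\mathbb{K}$, viewed via structure constants as a subset of the affine space $\mathbb{K}^{24}$, is an affine algebraic variety embedded in $\mathbb{K}^{24}$, i.e. it is the common zero set in $\mathbb{K}^{24}$ of a family of polynomials in the $24$ structure constants.
   Context: A skew-symmetric algebra over $\mathbb{K}$ is a pair $(\mathcal{A},\mu)$ with $\mathcal{A}$ a $\mathbb{K}$-vector space and $\mu:\mathcal{A}\times\mathcal{A}\to\mathcal{A}$ a skew-symmetric bilinear map. Fix the basis $\{e_1,e_2,e_3,e_4\}$ of $\mathbb{K}^4$. A skew-symmetric multiplication $\mu$ on $\mathbb{K}^4$ is identified with its structure constants $C_{i,j}^k$, $1\le i<j\le 4$, $1\le k\le 4$, defined by $\mu(e_i,e_j)=\sum_k C_{i,j}^k e_k$; this identifies the set of all $4$-dimensional skew-symmetric algebras with $\mathbb{K}^{24}$. The algebra $(\mathcal{A},\mu)$ is called a Hom-Lie algebra if there is a nonzero linear endomorphism $f$ of $\mathcal{A}$ such that $\mu(\mu(x,y),f(z))+\mu(\mu(y,z),f(x))+\mu(\mu(z,x),f(y))=0$ for all $x,y,z\in\mathcal{A}$. $\mathcal{HL}_4\subset\mathbb{K}^{24}$ is the set of skew-symmetric multiplications that are Hom-Lie. *)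

(* Defs.v *)
From HB Require Import structures.
From mathcomp Require Import all_boot all_order all_algebra.
From mathcomp Require Export mpoly.

Set Implicit Arguments.
Unset Strict Implicit.
Unset Printing Implicit Defensive.

Import GRing.Theory.
Local Open Scope ring_scope.

Definition skew_symmetric (K : fieldType) (A : lmodType K)
    (mu : {bilinear A -> A -> A}) : Prop :=
  forall x y : A, mu x y = - mu y x.

Definition hom_lie (K : fieldType) (A : lmodType K)
    (mu : {bilinear A -> A -> A}) : Prop :=
  exists f : {linear A -> A}, (exists x : A, f x != 0) /\
    forall x y z : A,
      mu (mu x y) (f z) + mu (mu y z) (f x) + mu (mu z x) (f y) = 0.

Definition std_basis (K : fieldType) (n : nat) (i : 'I_n) : 'rV[K]_n :=
  delta_mx 0 i.

(* Numbering of the structure constants C_{i,j}^k, with indices starting from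
   0: the pairs i < j in 'I_4 are numbered by 'C(j, 2) + i, that is, as
   01, 02, 12, 03, 13, 23, and k varies fastest. Only used when i < j, in which
   case the value is < 24 and the numbering is a bijection (sc_index_val,
   sc_index_onto). *)
Definition sc_index (i j k : 'I_4) : 'I_24 := inord (4 * ('C(j, 2) + i) + k).

Lemma sc_index_val (i j k : 'I_4) : (i < j)%N ->
  sc_index i j k = (4 * ('C(j, 2) + i) + k)%N :> nat.
Proof.
case: i j k => [[|[|[|[|i]]]] hi] [[|[|[|[|j]]]] hj] // [k hk] _;
  by rewrite inordK //=; case: k hk => [|[|[|[|k]]]].
Qed.

Lemma sc_index_onto (m : 'I_24) :
  exists i j k : 'I_4, (i < j)%N /\ sc_index i j k = m.
Proof.
have [i [j [lt_ij def_m]]] : exists i j : 'I_4,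
    (i < j)%N /\ ('C(j, 2) + i = m %/ 4)%N.
  have: (m %/ 4 < 6)%N by rewrite ltn_divLR.
  by case: (m %/ 4)%N => [|[|[|[|[|[|//]]]]]] _;
    [exists (inord 0), (inord 1) | exists (inord 0), (inord 2)
    |exists (inord 1), (inord 2) | exists (inord 0), (inord 3)
    |exists (inord 1), (inord 3) | exists (inord 2), (inord 3)];
    rewrite !inordK.
exists i, j, (inord (m %% 4)); split=> //; apply/val_inj.
by rewrite /= sc_index_val // inordK ?ltn_mod // def_m mulnC -divn_eq.
Qed.

Definition has_structure_constants (K : fieldType)
    (mu : {bilinear 'rV[K]_4 -> 'rV[K]_4 -> 'rV[K]_4}) (c : 'rV[K]_24) : Prop :=
  forall i j : 'I_4, (i < j)%N ->
    mu (std_basis K i) (std_basis K j) =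
      \sum_(k < 4) c 0 (sc_index i j k) *: std_basis K k.

Definition HL4 (K : fieldType) (c : 'rV[K]_24) : Prop :=
  exists mu : {bilinear 'rV[K]_4 -> 'rV[K]_4 -> 'rV[K]_4},
    [/\ skew_symmetric mu, hom_lie mu & has_structure_constants mu c].

Definition affine_algebraic_variety (K : fieldType) (n : nat)
    (S : 'rV[K]_n -> Prop) : Prop :=
  exists P : {mpoly K[n]} -> Prop,
    forall c : 'rV[K]_n, S c <-> forall p, P p -> p.@[c 0] = 0.

(* Main.v *)
From HB Require Import structures.
Require Import Defs.
From mathcomp Require Import all_boot all_order all_algebra.

(** For a fixed multiplication mu on K^4, the Hom-Jacobi identity is linear in
    the endomorphism f: writing f as a 4 x 4 matrix and testing the identity on
    basis vectors only, it becomes a homogeneous linear system in the 16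
    entries of f, whose coefficients are quadratic polynomials in the structure
    constants of mu ([hom_lie_linear_system]). So mu is Hom-Lie exactly when
    this system has a nontrivial solution.

    A homogeneous system has a nontrivial solution exactly when its coefficient
    matrix does not have full rank, that is, when all its maximal minors vanish
    ([nonzero_kernel_minors]). These minors are polynomials in the parameters
    of the system; hence a set of parameters defined by solvability of such a
    system is always an affine variety ([nontrivial_solution_variety]).

    It remains to express mu by its structure constants. A point c of K^24
    determines a skew-symmetric multiplication, whose constants on all pairs of
    indices are 0 or, up to sign, a coordinate of c ([struct_poly]). This is the
    only skew-symmetric multiplication with structure constants c, because
    skew-symmetry forces mu(e_i, e_i) = 0 when 2 is invertible
    ([struct_table_unique]). *)

Set Implicit Arguments.
Unset Strict Implicit.
Unset Printing Implicit Defensive.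
Import GRing.Theory.
Local Open Scope ring_scope.

(** A matrix of rank p has p independent columns, and they form an invertible
    submatrix; conversely a linear relation between the rows of A is one between
    the rows of each of its submatrices. The map s ranges over all functions:
    repeating a column only adds minors that are 0. *)
Lemma row_free_minorP (F : fieldType) (p q : nat) (A : 'M[F]_(p, q)) :
  row_free A <-> exists s : 'I_p -> 'I_q, \det (colsub s A) != 0.
Proof.
split=> [freeA | [s det_s]].
  have fullAt : row_full A^T by rewrite /row_full mxrank_tr.
  exists (fullrankfun fullAt).
  have := fullrowsub_unit fullAt.
  by rewrite unitmxE unitfE -det_tr trmx_mxsub trmxK.
apply: inj_row_free => v vA0.
have unit_s : colsub s A \in unitmx by rewrite unitmxE unitfE.
rewrite -[v](mulmxK unit_s) mulmx_colsub vA0.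
by rewrite (_ : colsub s 0 = 0) ?mul0mx //; apply/matrixP=> i j; rewrite !mxE.
Qed.

Lemma nonzero_kernel_minors (F : fieldType) (p q : nat) (A : 'M[F]_(p, q)) :
  (exists2 v : 'rV_p, v != 0 & v *m A = 0) <->
    forall s : 'I_p -> 'I_q, \det (colsub s A) = 0.
Proof.
split=> [[v v_neq0 vA0] s | minors0].
  apply/eqP/negPn/negP => det_s; case/negP: v_neq0; apply/eqP.
  have /row_free_inj freeA : row_free A by apply/row_free_minorP; exists s.
  by apply: freeA; rewrite mul0mx.
have : kermx A != 0.
  by rewrite kermx_eq0; apply/negP=> /row_free_minorP[s /eqP]; apply.
case/rowV0Pn => v /sub_kermxP vA0 v_neq0.
by exists v.
Qed.

(** The minors of the matrix of values of the M i j are the values of the minors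
    of M, because evaluation is a ring morphism; their vanishing is therefore a
    family of polynomial equations in c. Unknowns and equations are indexed by
    arbitrary finite types so that pairs and tuples of indices can be used as
    they are. *)
Lemma nontrivial_solution_variety (K : fieldType) (n : nat) (I J : finType)
    (M : I -> J -> {mpoly K[n]}) :
  affine_algebraic_variety (fun c : 'rV[K]_n =>
    exists2 v : I -> K, exists i, v i != 0 &
      forall j, \sum_i v i * (M i j).@[c 0] = 0).
Proof.
pose A : 'M[{mpoly K[n]}]_(#|I|, #|J|) :=
  \matrix_(i, j) M (enum_val i) (enum_val j).
exists (fun p => exists s, p = \det (colsub s A)) => c.
pose Ac := map_mx (meval (c 0)) A.
have detE s : \det (colsub s Ac) = (\det (colsub s A)).@[c 0].
  by rewrite -det_map_mx map_mxsub.
have vAcE (v : 'rV_#|I|) j :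
    (v *m Ac) 0 j =
      \sum_i v 0 (enum_rank i) * (M i (enum_val j)).@[c 0].
  rewrite mxE (reindex _ (onW_bij _ (@enum_rank_bij I))) /=.
  apply: eq_bigr => i _.
  by rewrite !mxE enum_rankK.
have [ker_minors minors_ker] := nonzero_kernel_minors Ac.
split=> [[v [i vi_neq0] vM0] _ [s ->] | minors0].
  rewrite -detE; apply: ker_minors.
  exists (\row_i v (enum_val i)).
    apply: contra_neq vi_neq0 => /rowP/(_ (enum_rank i)).
    by rewrite !mxE enum_rankK.
  apply/rowP=> j; rewrite vAcE [RHS]mxE -[RHS](vM0 (enum_val j)).
  by apply: eq_bigr => k _; rewrite mxE enum_rankK.
have [|v /rV0Pn[i vi_neq0] vA0] := minors_ker.
  by move=> s; rewrite detE; apply: minors0; exists s.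
exists (fun i => v 0 (enum_rank i)).
  by exists (enum_val i); rewrite enum_valK.
move=> j; have /rowP/(_ (enum_rank j)) := vA0.
by rewrite vAcE mxE enum_rankK.
Qed.

Lemma linear_eq0 (R : pzRingType) (n : nat) (V : lmodType R)
    (h : 'rV[R]_n -> V) : linear h ->
  (forall i, h (delta_mx 0 i) = 0) -> forall x, h x = 0.
Proof.
move=> lin_h h0 x.
pose hL : {linear 'rV[R]_n -> V} :=
  HB.pack h (GRing.isLinear.Build R _ _ _ h lin_h).
rewrite -[h]/(hL : _ -> _) (row_sum_delta x) linear_sum /=.
by apply: big1 => i _; rewrite (scalable_linear lin_h) /= h0 scaler0.
Qed.

Lemma bilinear_ext (K : fieldType) (n : nat) (V : lmodType K)
    (mu nu : {bilinear 'rV[K]_n -> 'rV[K]_n -> V}) :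
  (forall i j, mu (std_basis K i) (std_basis K j) =
               nu (std_basis K i) (std_basis K j)) ->
  forall x y, mu x y = nu x y.
Proof.
move=> eq_basis x y; apply/eqP; rewrite -subr_eq0; apply/eqP.
move: x; apply: (@linear_eq0 _ _ _ (fun x => mu x y - nu x y)).
  by move=> a u v; rewrite !linearPl scalerBr opprD addrACA.
move=> i; move: y; apply: (@linear_eq0 _ _ _ (fun y => mu _ y - nu _ y)).
  by move=> a u v; rewrite !linearPr scalerBr opprD addrACA.
by move=> j; rewrite [mu _ _]eq_basis subrr.
Qed.

(** Stated for bare functions, so that it applies to a multiplication and an
    endomorphism independently of their linear structures. *)
Definition hom_jacobiator (K : fieldType) (A : lmodType K)
    (mu : A -> A -> A) (f : A -> A) (x y z : A) : A :=
  mu (mu x y) (f z) + mu (mu y z) (f x) + mu (mu z x) (f y).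

(** Thanks to this symmetry, linearity of the Hom-Jacobiator in its first
    argument is enough to have it in all three. *)
Lemma hom_jacobiator_rot (K : fieldType) (A : lmodType K)
    (mu : A -> A -> A) (f : A -> A) (x y z : A) :
  hom_jacobiator mu f x y z = hom_jacobiator mu f y z x.
Proof. by rewrite /hom_jacobiator -addrA addrC. Qed.

Lemma hom_jacobiator_basis (K : fieldType) (n : nat)
    (mu : {bilinear 'rV[K]_n -> 'rV[K]_n -> 'rV[K]_n})
    (f : {linear 'rV[K]_n -> 'rV[K]_n}) :
  (forall i j k, hom_jacobiator mu f
      (std_basis K i) (std_basis K j) (std_basis K k) = 0) ->
  forall x y z, hom_jacobiator mu f x y z = 0.
Proof.
move=> basis0.
have lin_jac y z : linear (fun x => hom_jacobiator mu f x y z).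
  move=> a u v; rewrite /hom_jacobiator linearP.
  rewrite !(linearPl, linearPr) !scalerDr.
  by rewrite [X in X + _ = _]addrACA [LHS]addrACA.
move=> x y z; move: x; apply: linear_eq0 (lin_jac _ _) _ => i.
rewrite hom_jacobiator_rot; move: y; apply: linear_eq0 (lin_jac _ _) _ => j.
rewrite hom_jacobiator_rot; move: z; apply: linear_eq0 (lin_jac _ _) _ => k.
by rewrite hom_jacobiator_rot; apply: basis0.
Qed.

Definition table_mul (K : fieldType) (n : nat) (g : 'I_n -> 'I_n -> 'rV[K]_n)
    (x y : 'rV[K]_n) : 'rV[K]_n :=
  \sum_i \sum_j (x 0 i * y 0 j) *: g i j.

Lemma table_mul_bilinear (K : fieldType) (n : nat)
    (g : 'I_n -> 'I_n -> 'rV[K]_n) :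
  bilinear_for *:%R *:%R (table_mul g).
Proof.
split=> w a u v; rewrite /table_mul /= scaler_sumr -big_split /=.
all: apply: eq_bigr => i _; rewrite scaler_sumr -big_split /=.
all: apply: eq_bigr => j _; rewrite scalerA -scalerDl !mxE.
  by rewrite mulrDl mulrA.
by rewrite mulrDr mulrCA.
Qed.

HB.instance Definition _ (K : fieldType) (n : nat)
    (g : 'I_n -> 'I_n -> 'rV[K]_n) :=
  bilinear_isBilinear.Build K _ _ _ *:%R *:%R (table_mul g)
    (table_mul_bilinear g).

Lemma table_mul_basis (K : fieldType) (n : nat) (g : 'I_n -> 'I_n -> 'rV[K]_n)
    (i j : 'I_n) : table_mul g (std_basis K i) (std_basis K j) = g i j.
Proof.
rewrite /table_mul (bigD1 i) //= [X in _ + X]big1 => [|k ki]; last first.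
  by apply: big1 => l _; rewrite mxE (negbTE ki) mul0r scale0r.
rewrite addr0 (bigD1 j) //= [X in _ + X]big1 => [|l lj]; last first.
  by rewrite [X in _ * X]mxE (negbTE lj) mulr0 scale0r.
by rewrite !mxE !eqxx mulr1 scale1r addr0.
Qed.

Lemma table_mul_coord (K : fieldType) (n : nat) (g : 'I_n -> 'I_n -> 'rV[K]_n)
    (x y : 'rV[K]_n) (k : 'I_n) :
  table_mul g x y 0 k = \sum_i \sum_j x 0 i * y 0 j * g i j 0 k.
Proof.
rewrite summxE; apply: eq_bigr => i _; rewrite summxE.
by apply: eq_bigr => j _; rewrite mxE.
Qed.

(** The structure constant of (e_i, e_j) on e_k, as a function of the 24
    coordinates, for all i and j: only the constants with i < j are coordinates,
    and skew-symmetry gives the others. *)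
Definition struct_poly (K : fieldType) (i j k : 'I_4) : {mpoly K[24]} :=
  if (i < j)%N then 'X_(sc_index i j k)
  else if (j < i)%N then - 'X_(sc_index j i k) else 0.

Definition struct_table (K : fieldType) (c : 'rV[K]_24) (i j : 'I_4) :
    'rV[K]_4 :=
  \row_k (struct_poly K i j k).@[c 0].

Lemma struct_table_skew (K : fieldType) (c : 'rV[K]_24) (i j : 'I_4) :
  struct_table c i j = - struct_table c j i.
Proof.
apply/rowP => k; rewrite !mxE /struct_poly.
by case: ltngtP => _; rewrite ?mevalN ?meval0 ?opprK ?oppr0.
Qed.

Lemma struct_table_mul_skew (K : fieldType) (c : 'rV[K]_24) :
  skew_symmetric (table_mul (struct_table c)).
Proof.
move=> x y; rewrite /= /table_mul [LHS]exchange_big /= -sumrN.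
apply: eq_bigr => i _.
rewrite -sumrN; apply: eq_bigr => j _.
by rewrite struct_table_skew scalerN mulrC.
Qed.

Lemma struct_tableE (K : fieldType) (c : 'rV[K]_24) (i j : 'I_4) : (i < j)%N ->
  struct_table c i j = \sum_(k < 4) c 0 (sc_index i j k) *: std_basis K k.
Proof.
move=> lt_ij; rewrite [LHS]row_sum_delta; apply: eq_bigr => k _.
by rewrite mxE /struct_poly lt_ij mevalXU.
Qed.

(** On the diagonal, skew-symmetry reads w = - w, which kills w as soon as 2 is
    nonzero. *)
Lemma struct_table_unique (K : fieldType) (c : 'rV[K]_24)
    (mu : {bilinear 'rV[K]_4 -> 'rV[K]_4 -> 'rV[K]_4}) :
  2%:R != 0 :> K -> skew_symmetric mu -> has_structure_constants mu c ->
  forall x y, mu x y = table_mul (struct_table c) x y.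
Proof.
move=> two_neq0 skew_mu mu_c; apply: bilinear_ext => i j.
rewrite /= table_mul_basis; case: (ltngtP i j) => [lt_ij | lt_ji | /val_inj <-].
- by rewrite mu_c // struct_tableE.
- by rewrite skew_mu struct_table_skew mu_c // struct_tableE.
have eq0_of_skew (w : 'rV[K]_4) : w = - w -> w = 0.
  move/eqP; rewrite -subr_eq0 opprK -mulr2n -scaler_nat scaler_eq0.
  by rewrite (negbTE two_neq0) => /eqP.
rewrite [LHS]eq0_of_skew; last exact: skew_mu.
by rewrite [RHS]eq0_of_skew //; apply: struct_table_skew.
Qed.

Lemma HL4E (K : fieldType) (c : 'rV[K]_24) : 2%:R != 0 :> K ->
  HL4 c <-> hom_lie (table_mul (struct_table c)).
Proof.
move=> two_neq0; split=> [[mu [skew_mu [f [f_neq0 jac0]] mu_c]] | hom_c].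
  exists f; split=> // x y z.
  by rewrite /= -!(struct_table_unique two_neq0 skew_mu mu_c).
exists (table_mul (struct_table c)); split=> //.
  exact: struct_table_mul_skew.
by move=> i j lt_ij; rewrite /= table_mul_basis struct_tableE.
Qed.

Lemma hom_lie_matrixP (K : fieldType) (n : nat)
    (mu : {bilinear 'rV[K]_n -> 'rV[K]_n -> 'rV[K]_n}) :
  hom_lie mu <-> exists2 A : 'M[K]_n, A != 0 &
    forall i j k, hom_jacobiator mu (mulmxr A)
      (std_basis K i) (std_basis K j) (std_basis K k) = 0.
Proof.
split=> [[f [[x fx_neq0] jac0]] | [A A_neq0 jac0]].
  exists (lin1_mx f).
    by apply: contra_neq fx_neq0 => f0; rewrite -mul_rV_lin1 f0 mulmx0.
  by move=> i j k; rewrite /hom_jacobiator /= !mul_rV_lin1; apply: jac0.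
exists (mulmxr A); split; last exact: hom_jacobiator_basis.
have [i rowA] : exists i, row i A != 0.
  apply/existsP; apply: contraNT A_neq0 => /existsPn rowA.
  by apply/eqP/row_matrixP => i; rewrite row0; apply/eqP/negPn/rowA.
by exists (delta_mx 0 i); rewrite /= -rowE.
Qed.

(** For the elementary endomorphism f that sends e_a to e_b and the other basis
    vectors to 0, with ab = (a, b), this is the coordinate on e_l of
    mu(mu(e_i, e_j), f(e_k)). *)
Definition twisted_mul_poly (K : fieldType) (i j k l : 'I_4)
    (ab : 'I_4 * 'I_4) : {mpoly K[24]} :=
  (ab.1 == k)%:R * \sum_m struct_poly K i j m * struct_poly K m ab.2 l.

(** Coefficient of the unknown A a b, with ab = (a, b), in the equation stating
    that the coordinate on e_l of the Hom-Jacobiator of (e_i, e_j, e_k)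
    vanishes, where e = ((i, j), (k, l)). *)
Definition hom_jacobi_poly (K : fieldType) (ab : 'I_4 * 'I_4)
    (e : 'I_4 * 'I_4 * ('I_4 * 'I_4)) : {mpoly K[24]} :=
  let: ((i, j), (k, l)) := e in
  twisted_mul_poly K i j k l ab + twisted_mul_poly K j k i l ab
    + twisted_mul_poly K k i j l ab.

Lemma twisted_mul_polyE (K : fieldType) (c : 'rV[K]_24) (A : 'M[K]_4)
    (i j k l : 'I_4) :
  table_mul (struct_table c) (table_mul (struct_table c)
      (std_basis K i) (std_basis K j)) (mulmxr A (std_basis K k)) 0 l =
    \sum_ab A ab.1 ab.2 * (twisted_mul_poly K i j k l ab).@[c 0].
Proof.
rewrite table_mul_basis table_mul_coord.
rewrite -(pair_bigA _
  (fun a b => A a b * (twisted_mul_poly K i j k l (a, b)).@[c 0])).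
(* Only the row k of A contributes, since f(e_k) = \sum_b A k b e_b *)
rewrite [RHS](bigD1 k) //= [X in _ = _ + X]big1 => [|a ak]; last first.
  apply: big1 => b _.
  by rewrite /twisted_mul_poly (negbTE ak) mul0r meval0 mulr0.
rewrite addr0 exchange_big; apply: eq_bigr => b _ /=.
rewrite /twisted_mul_poly eqxx mul1r raddf_sum mulr_sumr.
apply: eq_bigr => m _.
by rewrite /= mevalM /struct_table -rowE !mxE mulrCA mulrA.
Qed.

Lemma hom_jacobi_polyE (K : fieldType) (c : 'rV[K]_24) (A : 'M[K]_4)
    (i j k l : 'I_4) :
  hom_jacobiator (table_mul (struct_table c)) (mulmxr A)
      (std_basis K i) (std_basis K j) (std_basis K k) 0 l =
    \sum_ab A ab.1 ab.2 * (hom_jacobi_poly K ab ((i, j), (k, l))).@[c 0].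
Proof.
rewrite /hom_jacobiator [LHS]mxE [X in X + _]mxE !twisted_mul_polyE.
rewrite -!big_split /=.
by apply: eq_bigr => ab _; rewrite -!mulrDr -!mevalD.
Qed.

Lemma hom_lie_linear_system (K : fieldType) (c : 'rV[K]_24) :
  hom_lie (table_mul (struct_table c)) <->
    exists2 v : 'I_4 * 'I_4 -> K, exists ab, v ab != 0 &
      forall e, \sum_ab v ab * (hom_jacobi_poly K ab e).@[c 0] = 0.
Proof.
split=> [/hom_lie_matrixP[A A_neq0 jac0] | [v [[a b] v_neq0] sys0]].
  exists (fun ab => A ab.1 ab.2).
    by have /matrix0Pn[a [b]] := A_neq0; exists (a, b).
  by case=> [[i j] [k l]]; rewrite -hom_jacobi_polyE jac0 mxE.
apply/hom_lie_matrixP; exists (\matrix_(a, b) v (a, b)).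
  by apply/matrix0Pn; exists a, b; rewrite mxE.
move=> i j k; apply/rowP=> l; rewrite hom_jacobi_polyE [RHS]mxE.
rewrite -[RHS](sys0 ((i, j), (k, l))).
by apply: eq_bigr => -[a' b'] _; rewrite mxE.
Qed.

Theorem proposition3 (K : fieldType) (charK0 : [pchar K] =i pred0) :
  affine_algebraic_variety (@HL4 K).
Proof.
have [P PE] := nontrivial_solution_variety (@hom_jacobi_poly K).
exists P => c; rewrite -PE.
have two_neq0 : 2%:R != 0 :> K by have /pcharf0P -> := charK0.
exact: iff_trans (HL4E c two_neq0) (hom_lie_linear_system c).
Qed.
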